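(* For every integer $n$ such that $|n|>1$, the group $H_n$ is non-linear; that is, there is no field $F$ and integer $m$ admitting an injective homomorphism $H_n\to \mathrm{GL}(m,F)$.
   Context: Let $\mathbb{F}_2$ be the field with two elements, $t$ an indeterminate, and let $G$ be the subgroup of $\mathrm{GL}(3,\mathbb{F}_2[t,t^{-1}])$ generated by $c=\begin{pmatrix} t & 1+t & 1+t\\ 1+t & t & 1+t\\ 1+t & 1+t & t\end{pmatrix}$ and $d=\begin{pmatrix} t&0&0\\0&1&0\\0&0&1\end{pmatrix}$. For each nonzero integer $n$, let $\rho_n$ be the injective endomorphism of $\mathrm{GL}(3,\mathbb{F}_2[t,t^{-1}])$ obtained by substituting $t\mapsto t^n$ in every matrix entry. One has $\rho_n(c)=c^n$ and $\rho_n(d)=d^n$, so $\rho_n$ restricts to an injective endomorphism $\rho_n|_G:G\to G$. Let $H_n$ be the (ascending) HNN extension of $G$ by $\rho_n|_G$, i.e. $H_n=\langle G,\tau \mid \tau g\tau^{-1}=\rho_n(g),\ g\in G\rangle$. A group is linear if it admits an injective homomorphism into $\mathrm{GL}(m,F)$ for some field $F$ and some integer $m$. *)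

(* Defs.v *)
From HB Require Import structures.
From mathcomp Require Import all_boot all_order all_algebra.
From mathcomp Require Import generic_quotient fraction boolp ring.

Set Implicit Arguments.
Unset Strict Implicit.
Unset Printing Implicit Defensive.

Import GRing.Theory.

(* GL(n, R) for an arbitrary, possibly infinite, commutative ring R; the
   library's {'GL_n[R]} requires R to be finite. *)
Section GeneralLinear.
Local Open Scope ring_scope.
Variables (n : nat) (R : comUnitRingType).

Record GL := MkGL { gl_mx :> 'M[R]_n; gl_unit : gl_mx \in unitmx }.

HB.instance Definition _ := [isSub for gl_mx].
HB.instance Definition _ := [Choice of GL by <:].

Lemma gl_mul_subproof (A B : GL) : A *m B \in unitmx.
Proof. by rewrite unitmx_mul !gl_unit. Qed.

Lemma gl_inv_subproof (A : GL) : invmx A \in unitmx.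
Proof. by rewrite unitmx_inv gl_unit. Qed.

Definition gl_one : GL := MkGL (unitmx1 R n).
Definition gl_mul (A B : GL) : GL := MkGL (gl_mul_subproof A B).
Definition gl_inv (A : GL) : GL := MkGL (gl_inv_subproof A).

Fact gl_mulA : associative gl_mul.
Proof. by move=> A B C; apply: val_inj; rewrite /= mulmxA. Qed.
Fact gl_mul1 : left_id gl_one gl_mul.
Proof. by move=> A; apply: val_inj; rewrite /= mul1mx. Qed.
Fact gl_mulr1 : right_id gl_one gl_mul.
Proof. by move=> A; apply: val_inj; rewrite /= mulmx1. Qed.
Fact gl_mulV : left_inverse gl_one gl_inv gl_mul.
Proof. by move=> A; apply: val_inj; rewrite /= mulVmx // gl_unit. Qed.
Fact gl_mulrV : right_inverse gl_one gl_inv gl_mul.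
Proof. by move=> A; apply: val_inj; rewrite /= mulmxV // gl_unit. Qed.

HB.instance Definition _ :=
  isGroup.Build GL gl_mulA gl_mul1 gl_mulr1 gl_mulV gl_mulrV.

Lemma gl_mxM (A B : GL) : (A * B)%g = A *m B :> 'M_n.
Proof. by []. Qed.
Lemma gl_mx1 : (1%g : GL) = 1%:M :> 'M_n.
Proof. by []. Qed.

End GeneralLinear.

Section MapGL.
Local Open Scope ring_scope.
Variables (n : nat) (R S : comUnitRingType) (f : {rmorphism R -> S}).

Lemma map_GL_subproof (A : GL n R) : map_mx f A \in unitmx.
Proof.
have [H _] : map_mx f A *m map_mx f (invmx A) = 1%:M /\ True.
  by rewrite -map_mxM mulmxV ?gl_unit // map_mx1.
by case: (mulmx1_unit H).
Qed.

Definition map_GL (A : GL n R) : GL n S := MkGL (map_GL_subproof A).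

Fact map_GL_M : {morph map_GL : A B / (A * B)%g}.
Proof. by move=> A B; apply: val_inj; rewrite /= map_mxM. Qed.

HB.instance Definition _ :=
  isMultiplicative.Build (GL n R) (GL n S) map_GL map_GL_M.
End MapGL.

Definition linear_group (H : groupType) : Prop :=
  exists (F : fieldType) (m : nat) (f : {multiplicative H -> GL m F}),
    injective f.

Section GeneratedSubgroup.
Local Open Scope group_scope.
Variable gT : groupType.

Definition gen (s : seq gT) : {pred gT} :=
  fun x => `[< forall H : {pred gT},
                 group_closed H -> {subset s <= H} -> x \in H >].

Lemma genP s x :
  reflect (forall H : {pred gT}, group_closed H -> {subset s <= H} -> x \in H)
          (x \in gen s).
Proof. exact: asboolP. Qed.

Lemma mem_gen s : {subset s <= gen s}.
Proof. by move=> x xs; apply/genP => H _; apply. Qed.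

Lemma gen_closed s : group_closed (gen s).
Proof.
split=> [|x y /genP Hx /genP Hy]; apply/genP => H HH sH.
  by case: HH.
by case: (HH) => _; apply; [apply: Hx | apply: Hy].
Qed.

Definition gen_type (s : seq gT) := {x : gT | x \in gen s}.

HB.instance Definition _ s := Choice.on (gen_type s).
HB.instance Definition _ s := SubType.on (gen_type s).
HB.instance Definition _ s :=
  SubChoice_isSubGroup.Build gT (gen s) (gen_type s) (gen_closed s).

End GeneratedSubgroup.

Section RestrictToGenerated.
Local Open Scope group_scope.
Variables (gT : groupType) (s : seq gT) (f : {multiplicative gT -> gT}).
Hypothesis fs : {in s, forall x, f x \in gen s}.

Lemma gen_stable x : x \in gen s -> f x \in gen s.
Proof.
pose H := [pred y | f y \in gen s].
have f1 : f 1 = 1 by apply: (mulgI (f 1)); rewrite -gmulfM !mulg1.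
have fV y : f y^-1 = (f y)^-1.
  by apply: (mulgI (f y)); rewrite -gmulfM !mulgV f1.
have [g1 gD] := gen_closed s.
move=> /genP/(_ H); apply=> [|y ys]; last exact: fs.
split=> [|y z]; first by rewrite inE f1.
by rewrite !inE gmulfM fV; apply: gD.
Qed.

Definition gen_restr (x : gen_type s) : gen_type s :=
  Sub (f (val x)) (gen_stable (valP x)).

Fact gen_restrM : {morph gen_restr : x y / x * y}.
Proof. by move=> x y; apply: val_inj; rewrite /= gmulfM. Qed.

HB.instance Definition _ :=
  isMultiplicative.Build (gen_type s) (gen_type s) gen_restr gen_restrM.
End RestrictToGenerated.

(* The ascending HNN extension <G, tau | tau g tau^-1 = phi g, g in G>: words
   in the elements of G (inl), tau (inr true) and tau^-1 (inr false), modulo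
   the congruence generated by the multiplication of G, the cancellation of
   tau with tau^-1, and the conjugation relations. *)
Section HNN.
Local Open Scope group_scope.
Local Open Scope quotient_scope.
Variables (G : groupType) (phi : {multiplicative G -> G}).

Definition hnn_word := seq (G + bool).

Inductive hnn_rel : hnn_word -> hnn_word -> Prop :=
| HnnRefl u : hnn_rel u u
| HnnSym u v : hnn_rel u v -> hnn_rel v u
| HnnTrans u v w : hnn_rel u v -> hnn_rel v w -> hnn_rel u w
| HnnCat u u' v v' : hnn_rel u u' -> hnn_rel v v' -> hnn_rel (u ++ v) (u' ++ v')
| HnnOne : hnn_rel [:: inl 1] [::]
| HnnMul g h : hnn_rel [:: inl g; inl h] [:: inl (g * h)]
| HnnCancel b : hnn_rel [:: inr b; inr (~~ b)] [::]
| HnnConj g : hnn_rel [:: inr true; inl g; inr false] [:: inl (phi g)].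

Definition hnn_relb : rel hnn_word := fun u v => `[< hnn_rel u v >].

Fact hnn_relb_refl : reflexive hnn_relb.
Proof. by move=> u; apply/asboolP; apply: HnnRefl. Qed.
Fact hnn_relb_sym : symmetric hnn_relb.
Proof. by move=> u v; apply/asboolP/asboolP => /HnnSym. Qed.
Fact hnn_relb_trans : transitive hnn_relb.
Proof.
by move=> v u w /asboolP uv /asboolP vw; apply/asboolP; apply: HnnTrans vw.
Qed.

Definition hnn_equiv :=
  EquivRel hnn_relb hnn_relb_refl hnn_relb_sym hnn_relb_trans.

Definition HNN := {eq_quot hnn_equiv}.
HB.instance Definition _ := Choice.on HNN.

Definition hnn_class (u : hnn_word) : HNN := \pi_HNN u.

Lemma hnn_classP u v : hnn_class u = hnn_class v <-> hnn_rel u v.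
Proof. by split=> [/eqquotP/asboolP//|uv]; apply/eqquotP/asboolP. Qed.

Lemma hnn_repr u : hnn_rel (repr (hnn_class u)) u.
Proof. by apply/hnn_classP; rewrite /hnn_class reprK. Qed.

Definition hnn_inv_letter (l : G + bool) : G + bool :=
  match l with inl g => inl g^-1 | inr b => inr (~~ b) end.
Definition hnn_inv_word (u : hnn_word) : hnn_word :=
  rev (map hnn_inv_letter u).

Definition hnn_one : HNN := hnn_class [::].
Definition hnn_mul (x y : HNN) : HNN := hnn_class (repr x ++ repr y).
Definition hnn_inv (x : HNN) : HNN := hnn_class (hnn_inv_word (repr x)).

Lemma hnn_letter_mulV l : hnn_rel [:: l; hnn_inv_letter l] [::].
Proof.
case: l => [g|b] /=; last exact: HnnCancel.
by apply: HnnTrans (HnnMul g g^-1) _; rewrite mulgV; apply: HnnOne.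
Qed.

Lemma hnn_word_mulV u : hnn_rel (u ++ hnn_inv_word u) [::].
Proof.
elim: u => [|l u IH]; first exact: HnnRefl.
rewrite /hnn_inv_word /= rev_cons -cats1 -/(hnn_inv_word u) catA.
apply: HnnTrans (hnn_letter_mulV l).
apply: (@HnnCat [:: l] [:: l] _ [:: hnn_inv_letter l] (HnnRefl _)).
exact: (@HnnCat _ [::] _ _ IH (HnnRefl _)).
Qed.

Lemma hnn_inv_letterK : involutive hnn_inv_letter.
Proof. by case=> [g|b] /=; rewrite ?invgK ?negbK. Qed.

Lemma hnn_inv_wordK : involutive hnn_inv_word.
Proof.
by move=> u; rewrite /hnn_inv_word map_rev revK mapK //; apply: hnn_inv_letterK.
Qed.

Lemma hnn_word_mulVl u : hnn_rel (hnn_inv_word u ++ u) [::].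
Proof. by have := hnn_word_mulV (hnn_inv_word u); rewrite hnn_inv_wordK. Qed.

Lemma hnn_mulE u v : hnn_mul (hnn_class u) (hnn_class v) = hnn_class (u ++ v).
Proof. by apply/hnn_classP; apply: HnnCat; apply: hnn_repr. Qed.

Lemma hnn_classK (x : HNN) : x = hnn_class (repr x).
Proof. by rewrite /hnn_class reprK. Qed.

Fact hnn_mulA : associative hnn_mul.
Proof.
move=> x y z; rewrite (hnn_classK x) (hnn_classK y) (hnn_classK z).
by rewrite !hnn_mulE catA.
Qed.
Fact hnn_mul1 : left_id hnn_one hnn_mul.
Proof. by move=> x; rewrite (hnn_classK x) hnn_mulE. Qed.
Fact hnn_mulr1 : right_id hnn_one hnn_mul.
Proof. by move=> x; rewrite (hnn_classK x) hnn_mulE cats0. Qed.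
Fact hnn_mulV : left_inverse hnn_one hnn_inv hnn_mul.
Proof.
move=> x; rewrite {2}(hnn_classK x) hnn_mulE; apply/hnn_classP.
exact: hnn_word_mulVl.
Qed.
Fact hnn_mulrV : right_inverse hnn_one hnn_inv hnn_mul.
Proof.
move=> x; rewrite {1}(hnn_classK x) hnn_mulE; apply/hnn_classP.
exact: hnn_word_mulV.
Qed.

HB.instance Definition _ :=
  isGroup.Build HNN hnn_mulA hnn_mul1 hnn_mulr1 hnn_mulV hnn_mulrV.

Definition hnn_base (g : G) : HNN := hnn_class [:: inl g].
Definition hnn_stable : HNN := hnn_class [:: inr true].

Lemma hnn_baseM : {morph hnn_base : g h / g * h}.
Proof.
move=> g h; apply/esym; rewrite [LHS]hnn_mulE; apply/hnn_classP.
exact: HnnMul.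
Qed.

HB.instance Definition _ := isMultiplicative.Build G HNN hnn_base hnn_baseM.

Lemma hnn_stableV : hnn_stable^-1 = hnn_class [:: inr false].
Proof.
apply: (mulgI hnn_stable); rewrite mulgV; apply/esym.
by rewrite [LHS]hnn_mulE; apply/hnn_classP; apply: HnnCancel.
Qed.

Lemma hnn_stableJ g :
  hnn_stable * hnn_base g * hnn_stable^-1 = hnn_base (phi g).
Proof.
rewrite hnn_stableV [X in X * _]hnn_mulE [LHS]hnn_mulE.
by apply/hnn_classP; apply: HnnConj.
Qed.

Section Lift.
Variables (K : groupType) (f : {multiplicative G -> K}) (k : K).
Hypothesis fk : forall g, k * f g * k^-1 = f (phi g).

Let eval_letter (l : G + bool) : K :=
  match l with inl g => f g | inr true => k | inr false => k^-1 end.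
Let eval (u : hnn_word) : K := foldr (fun l z => eval_letter l * z) 1 u.

Let eval_cat u v : eval (u ++ v) = eval u * eval v.
Proof. by elim: u => [|l u IH] /=; rewrite ?mul1g // IH mulgA. Qed.

Let eval_rel u v : hnn_rel u v -> eval u = eval v.
Proof.
elim=> {u v} //=.
- by move=> u v w _ -> _ ->.
- by move=> u u' v v' _ Hu _ Hv; rewrite !eval_cat Hu Hv.
- by apply: (mulgI (f 1)); rewrite mulg1 -gmulfM mulg1.
- by move=> g h; rewrite gmulfM !mulgA.
- by case; rewrite /= mulgA ?mulgV ?mulVg mulg1.
- by move=> g; rewrite !mulgA !mulg1 fk.
Qed.

Lemma hnn_lift : exists F : {multiplicative HNN -> K},
  (forall g, F (hnn_base g) = f g) /\ F hnn_stable = k.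
Proof.
pose F (x : HNN) := eval (repr x).
have FE u : F (hnn_class u) = eval u by apply/eval_rel/hnn_repr.
have FM : {morph F : x y / x * y}.
  by move=> x y; rewrite [x * y]/(hnn_mul x y) FE eval_cat.
pose Fm := HB.pack_for {multiplicative HNN -> K} F
  (isMultiplicative.Build _ _ F FM).
by exists Fm; split=> [g|]; rewrite [LHS]FE /= mulg1.
Qed.
End Lift.

End HNN.

(* K[t, t^-1], as the subring of K(t) of the quotients p / t ^ k. *)
Section Laurent.
Local Open Scope ring_scope.
Variable K : fieldType.
Local Notation Kt := {fraction {poly K}}.
Local Notation "p %:F" := (@FracField.tofrac {poly K} p).

Definition laurent_pred : {pred Kt} :=
  fun x => `[< exists pk : {poly K} * nat, x = pk.1%:F / 'X%:F ^+ pk.2 >].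

Lemma laurentP x :
  reflect (exists pk : {poly K} * nat, x = pk.1%:F / 'X%:F ^+ pk.2)
          (x \in laurent_pred).
Proof. exact: asboolP. Qed.

Lemma fracX_neq0 k : ('X%:F : Kt) ^+ k != 0.
Proof. by rewrite expf_neq0 // tofrac_eq0 polyX_eq0. Qed.

Fact laurent_closed : subring_closed laurent_pred.
Proof.
split.
- by apply/laurentP; exists (1, 0%N); rewrite expr0 divr1 tofrac1.
- move=> _ _ /laurentP[[p k] ->] /laurentP[[q l] ->]; apply/laurentP => /=.
  exists (p * 'X ^+ l - q * 'X ^+ k, (k + l)%N) => /=.
  rewrite tofracB !tofracM !tofracXn exprD mulrBl.
  by rewrite -mulf_div divff ?fracX_neq0 // mulr1
    [_ ^+ k * _ ^+ l]mulrC -mulf_div divff ?fracX_neq0 // mulr1.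
- move=> _ _ /laurentP[[p k] ->] /laurentP[[q l] ->]; apply/laurentP => /=.
  by exists (p * q, (k + l)%N); rewrite /= tofracM exprD mulf_div.
Qed.

HB.instance Definition _ := GRing.isSubringClosed.Build Kt laurent_pred
  laurent_closed.

Record laurent := MkLaurent
  { laurent_val :> Kt; laurent_valP : laurent_val \in laurent_pred }.

HB.instance Definition _ := [isSub for laurent_val].
HB.instance Definition _ := [Choice of laurent by <:].
HB.instance Definition _ := [SubChoice_isSubComNzRing of laurent by <:].

Definition laurent_unit : {pred laurent} :=
  fun f => (val f != 0) && ((val f)^-1 \in laurent_pred).
Definition laurent_inv (f : laurent) : laurent :=
  if f \in laurent_unit then insubd f (val f)^-1 else f.

Fact laurent_mulV : {in laurent_unit, left_inverse 1 laurent_inv *%R}.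
Proof.
move=> f uf; apply: val_inj; rewrite /laurent_inv uf rmorphM rmorph1.
by case/andP: uf => nz uf; rewrite [X in X * _](insubdK f uf) mulVf.
Qed.
Fact laurent_unitP (f g : laurent) : g * f = 1 -> laurent_unit f.
Proof.
move=> /(congr1 val); rewrite rmorphM rmorph1 /= => gf.
have nz : val f != 0.
  by apply/eqP => f0; move: gf; rewrite f0 mulr0 => /eqP; rewrite eq_sym oner_eq0.
by rewrite /laurent_unit nz (mulr1_eq (etrans (mulrC (val f) (val g)) gf))
  (valP g).
Qed.
Fact laurent_inv_out : {in [predC laurent_unit], laurent_inv =1 id}.
Proof. by move=> f; rewrite inE /= /laurent_inv => /negbTE ->. Qed.

HB.instance Definition _ := GRing.ComNzRing_hasMulInverse.Build laurent
  laurent_mulV laurent_unitP laurent_inv_out.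
HB.instance Definition _ :=
  [SubComUnitRing_isSubIntegralDomain of laurent by <:].

Fact laurent_poly_subproof (p : {poly K}) : p%:F \in laurent_pred.
Proof. by apply/laurentP; exists (p, 0%N); rewrite expr0 divr1. Qed.

Definition laurent_poly (p : {poly K}) : laurent :=
  MkLaurent (laurent_poly_subproof p).

Fact laurent_poly_zmod : zmod_morphism laurent_poly.
Proof. by move=> p q; apply: val_inj; rewrite rmorphB /= tofracB. Qed.
Fact laurent_poly_monoid : monoid_morphism laurent_poly.
Proof.
split=> [|p q]; apply: val_inj; first by rewrite rmorph1 /= tofrac1.
by rewrite rmorphM /= tofracM.
Qed.
HB.instance Definition _ :=
  GRing.isZmodMorphism.Build _ _ laurent_poly laurent_poly_zmod.
HB.instance Definition _ :=
  GRing.isMonoidMorphism.Build _ _ laurent_poly laurent_poly_monoid.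

Definition laurentC : K -> laurent := laurent_poly \o polyC.
HB.instance Definition _ := GRing.RMorphism.on laurentC.

Definition laurentX : laurent := laurent_poly 'X.

Lemma laurentX_unit : laurentX \is a GRing.unit.
Proof.
rewrite unfold_in /= /laurent_unit /= tofrac_eq0 polyX_eq0 /=.
by apply/laurentP; exists (1, 1%N); rewrite expr1 tofrac1 div1r.
Qed.

Lemma laurent_fracP (f : laurent) :
  exists pk : {poly K} * nat, val f = pk.1%:F / 'X%:F ^+ pk.2.
Proof. exact/laurentP/(valP f). Qed.

Definition laurent_frac (f : laurent) : {poly K} * nat :=
  projT1 (cid (laurent_fracP f)).

Lemma laurent_fracE (f : laurent) :
  laurent_val f = (laurent_frac f).1%:F / 'X%:F ^+ (laurent_frac f).2.
Proof. by rewrite /laurent_frac; case: cid. Qed.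

(* The substitution t |-> t ^ n: it maps p / t ^ k to p(t ^ n) / t ^ (n k),
   which does not depend on the choice of p and k by laurent_substE. *)
Definition laurent_subst (n : int) (f : laurent) : laurent :=
  let: (p, k) := laurent_frac f in
  (map_poly laurentC p).[laurentX ^ n] / (laurentX ^ n) ^+ k.

Lemma laurent_substE n (f : laurent) p k :
  f * laurentX ^+ k = laurent_poly p ->
  laurent_subst n f
    = (map_poly laurentC p).[laurentX ^ n] / (laurentX ^ n) ^+ k.
Proof.
have uX : laurentX ^ n \is a GRing.unit by rewrite unitrXz // laurentX_unit.
move=> fp; rewrite /laurent_subst; have := laurent_fracE f.
case: (laurent_frac f) => q l /= fq.
have {}fq : f * laurentX ^+ l = laurent_poly q.
  by apply: val_inj; rewrite rmorphM rmorphXn /= fq divfK ?fracX_neq0.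
have pq : p * 'X ^+ l = q * 'X ^+ k.
  apply/eqP; rewrite -(tofrac_eq (p * _)); apply/eqP.
  have : laurent_poly p * laurentX ^+ l = laurent_poly q * laurentX ^+ k.
    by rewrite -fp -fq mulrAC.
  by move/(congr1 val); rewrite !(rmorphM, rmorphXn).
apply: (mulIr (unitrX k uX)); rewrite [in RHS]mulrVK ?unitrX //.
apply: (mulIr (unitrX l uX)); rewrite mulrAC mulrVK ?unitrX //.
have := congr1 (fun r => (map_poly laurentC r).[laurentX ^ n]) pq.
by rewrite !rmorphM !rmorphXn /= map_polyX !hornerM !horner_exp hornerX => ->.
Qed.

Lemma laurent_fracM (f : laurent) :
  f * laurentX ^+ (laurent_frac f).2 = laurent_poly (laurent_frac f).1.
Proof.
apply: val_inj; rewrite rmorphM rmorphXn /=.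
by rewrite [in LHS]laurent_fracE divfK ?fracX_neq0.
Qed.

Lemma laurent_subst_poly n p :
  laurent_subst n (laurent_poly p) = (map_poly laurentC p).[laurentX ^ n].
Proof. by rewrite (@laurent_substE n _ p 0%N) ?expr0 ?mulr1 ?divr1. Qed.

Fact laurent_subst_zmod n : zmod_morphism (laurent_subst n).
Proof.
have uX : laurentX ^ n \is a GRing.unit by rewrite unitrXz // laurentX_unit.
move=> f g; have := laurent_fracM f; have := laurent_fracM g.
case: (laurent_frac f) => p k; case: (laurent_frac g) => q l /= gq fp.
rewrite (laurent_substE n fp) (laurent_substE n gq).
rewrite (@laurent_substE n _ (p * 'X ^+ l - q * 'X ^+ k) (k + l)).
  rewrite rmorphB !rmorphM !rmorphXn /= map_polyX.
  rewrite hornerD hornerN !hornerM !horner_exp hornerX.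
  have uab : (laurentX ^ n) ^+ k * (laurentX ^ n) ^+ l \is a GRing.unit.
    by rewrite unitrM !unitrX.
  rewrite exprD; apply: (mulIr uab).
  rewrite [in LHS]mulrVK ?unitrM ?unitrX // mulrBl [in RHS]mulrA mulrVK ?unitrX //.
  by congr (_ - _); rewrite [X in _ = _ * X]mulrC mulrA mulrVK ?unitrX.
rewrite exprD mulrBl rmorphB !rmorphM !rmorphXn /= -fp -gq.
by congr (_ - _); rewrite mulrA // -!mulrA [laurentX ^+ l * _]mulrC.
Qed.

Fact laurent_subst_monoid n : monoid_morphism (laurent_subst n).
Proof.
have uX : laurentX ^ n \is a GRing.unit by rewrite unitrXz // laurentX_unit.
split=> [|f g].
  by rewrite -(rmorph1 laurent_poly) laurent_subst_poly !rmorph1 hornerC.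
have := laurent_fracM f; have := laurent_fracM g.
case: (laurent_frac f) => p k; case: (laurent_frac g) => q l /= gq fp.
rewrite (laurent_substE n fp) (laurent_substE n gq).
rewrite (@laurent_substE n _ (p * q) (k + l)).
  rewrite rmorphM hornerM exprD invrM ?unitrX // -!mulrA; congr (_ * _).
  by rewrite [RHS]mulrC -!mulrA.
by rewrite exprD mulrACA fp gq rmorphM.
Qed.

HB.instance Definition _ n := GRing.isZmodMorphism.Build laurent laurent
  (laurent_subst n) (laurent_subst_zmod n).
HB.instance Definition _ n := GRing.isMonoidMorphism.Build laurent laurent
  (laurent_subst n) (laurent_subst_monoid n).

Lemma laurent_substX n : laurent_subst n laurentX = laurentX ^ n.
Proof. by rewrite laurent_subst_poly map_polyX hornerX. Qed.

End Laurent.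

Section MainGroups.
Local Open Scope ring_scope.

Local Notation L := (laurent 'F_2).

Definition t : L := laurentX 'F_2.

(* The shapes of the matrices c and d, with t replaced by u. *)
Definition cmx (u : L) : 'M[L]_3 :=
  \matrix_(i, j) (if i == j then u else 1 + u).
Definition dmx (u : L) : 'M[L]_3 :=
  \matrix_(i, j) (if i != j then 0 else if i == 0 then u else 1).

Lemma addLL (x : L) : x + x = 0.
Proof.
have p2 : (2%:R : L) = 0.
  rewrite -(rmorph_nat (@laurentC 'F_2)).
  by rewrite (_ : 2%:R = 0 :> 'F_2) ?rmorph0 //; apply: val_inj.
by rewrite -mulr2n -mulr_natl p2 mul0r.
Qed.

Lemma cmxM (u v : L) : cmx u *m cmx v = cmx (u * v).
Proof.
have E := addLL (1 : L).
apply/matrixP => i j; rewrite !mxE !big_ord_recl big_ord0 !mxE.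
have cancel (x y z : L) : x = y + (z + z) -> x = y by rewrite addLL addr0.
case: i => -[|[|[|//]]] ?; case: j => -[|[|[|//]]] ?; rewrite /=;
  first [ by apply: (@cancel _ _ (1 + u + v + u * v)); ring
        | by apply: (@cancel _ _ (u + v + u * v)); ring ].
Qed.

Lemma dmxM (u v : L) : dmx u *m dmx v = dmx (u * v).
Proof.
apply/matrixP => i j; rewrite !mxE !big_ord_recl big_ord0 !mxE.
by case: i => -[|[|[|//]]] ?; case: j => -[|[|[|//]]] ?; rewrite /=; ring.
Qed.

Lemma cmx1 : cmx 1 = 1%:M.
Proof. by apply/matrixP => i j; rewrite !mxE addLL; case: (i == j). Qed.

Lemma dmx1 : dmx 1 = 1%:M.
Proof. by apply/matrixP => i j; rewrite !mxE; case: (i == j); case: (i == 0). Qed.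

Lemma t_unit : t \is a GRing.unit.
Proof. exact: laurentX_unit. Qed.

Lemma cmx_unit (n : int) : cmx (t ^ n) \in unitmx.
Proof.
have [] // := @mulmx1_unit _ _ (cmx (t ^ n)) (cmx (t ^ (- n))).
by rewrite cmxM -exprzDr ?t_unit // subrr expr0z cmx1.
Qed.

Lemma dmx_unit (n : int) : dmx (t ^ n) \in unitmx.
Proof.
have [] // := @mulmx1_unit _ _ (dmx (t ^ n)) (dmx (t ^ (- n))).
by rewrite dmxM -exprzDr ?t_unit // subrr expr0z dmx1.
Qed.

Definition c : GL 3 L := MkGL (cmx_unit 1).
Definition d : GL 3 L := MkGL (dmx_unit 1).

Lemma cE : c = \matrix_(i, j) (if i == j then t else 1 + t) :> 'M[L]_3.
Proof. by []. Qed.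

Lemma dE : d = diag_mx (\row_j (if j == 0 then t else 1)) :> 'M[L]_3.
Proof.
by apply/matrixP => i j; rewrite !mxE; case: eqP => [->|]; case: (_ == 0).
Qed.

Lemma subst_t n : laurent_subst n t = t ^ n.
Proof. exact: laurent_substX. Qed.

Definition rho (n : int) : GL 3 L -> GL 3 L := map_GL (laurent_subst n).
HB.instance Definition _ n := Multiplicative.on (rho n).

Definition gexpz (gT : groupType) (x : gT) (n : int) : gT :=
  match n with Posz k => (x ^+ k)%g | Negz k => (x ^- k.+1)%g end.

Lemma rho_pow (n : int) (f : L -> 'M[L]_3) (x : GL 3 L) :
  (forall u v, f u *m f v = f (u * v)) -> f 1 = 1%:M -> f t = x ->
  f (t ^ n) = gexpz x n.
Proof.
move=> fM f1 ft.
have fX k : f (t ^+ k) = (x ^+ k)%g.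
  by elim: k => [|k IH]; rewrite ?f1 // exprS expgS -fM IH ft.
case: n => k /=; first exact: fX.
rewrite -[LHS]mulmx1 -[1%:M](mulmxV (gl_unit (x ^+ k.+1)%g)) mulmxA -fX fM.
by rewrite NegzE -exprnN mulVr ?unitrX ?t_unit // f1 mul1mx fX.
Qed.

Lemma rho_c n : rho n c = gexpz c n.
Proof.
apply: val_inj; rewrite /= -(rho_pow n cmxM cmx1) //.
apply/matrixP => i j; rewrite !mxE.
rewrite -(subst_t n); case: (i == j) => //.
by rewrite [LHS]rmorphD [X in X + _ = _]rmorph1.
Qed.

Lemma rho_d n : rho n d = gexpz d n.
Proof.
apply: val_inj; rewrite /= -(rho_pow n dmxM dmx1) //.
apply/matrixP => i j; rewrite !mxE.
case: (i == j); rewrite /= ?rmorph0 //.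
by case: (i == 0); rewrite -?(subst_t n) // [LHS]rmorph1.
Qed.

Definition G := gen_type [:: c; d].
HB.instance Definition _ := Group.on G.

Lemma gen_expz (gT : groupType) (s : seq gT) x n :
  x \in gen s -> gexpz x n \in gen s.
Proof.
have [g1 gF] := gen_closed s; move=> xs.
have gV y : y \in gen s -> (y^-1)%g \in gen s.
  by move=> ys; rewrite -div1g; apply: gF.
have gX k : (x ^+ k)%g \in gen s.
  elim: k => [|k IH]; first by rewrite expg0.
  by rewrite expgS -[(x ^+ k)%g]invgK; apply: gF => //; apply: gV.
by case: n => k /=; rewrite ?gV.
Qed.

Lemma rho_gen n : {in [:: c; d], forall x, rho n x \in gen [:: c; d]}.
Proof.
move=> x xs; have := mem_gen xs; move: xs; rewrite !inE.
by case/orP=> /eqP ->; rewrite ?rho_c ?rho_d; apply: gen_expz.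
Qed.

Definition rhoG (n : int) : G -> G := gen_restr (@rho_gen n).
HB.instance Definition _ n := Multiplicative.on (rhoG n).

Definition H (n : int) : groupType := HNN (rhoG n).
End MainGroups.

(* Main.v *)
Require Import Defs.
From mathcomp Require Import all_boot all_order all_algebra.
From mathcomp Require Import boolp fraction fieldext ring zify.
Import Order.TTheory GRing.Theory Num.Theory.
Local Open Scope ring_scope.

(** Suppose that H_n embeds in GL(m, F). The base group G embeds in H_n
    ([hnn_base_inj], since the substitution t |-> t^n is injective by
    [rhoG_inj]), and the characteristic of F decides which feature of G gives
    the contradiction.

    If F has characteristic 2, the culprit is the relation tau c tau^-1 = c^n.
    The image x of c is conjugate to x^(n^2) under the image of tau^2, so
    raising to the power n^2 maps the finite set of eigenvalues of x into
    itself, and each eigenvalue is a root of unity. Hence a power x^N is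
    unipotent, and in positive characteristic a unipotent matrix has finite
    order ([torsion_of_conj_exp]). But c has infinite order in G.

    Otherwise G itself is not linear over F. The matrices c and d differ from
    the identity by rank one matrices supported on the span of e = (1,0,0) and
    v = (1,1,1), on which the form x.y is degenerate: with w = v - e, the flag
    <w> < <w, e> < F_2[t,t^-1]^3 is stable under c and d, which both act on its
    quotients by 1, t, 1. So c^k d^-k is unitriangular, and its square is
    1 + (t^k + t^-k) W, where W = w w^T satisfies W^2 = 0
    ([cmx_dmx_sqr]). These squares are infinitely many commuting involutions,
    whereas commuting involutions in GL(m, F) are simultaneously diagonalizable
    with eigenvalues 1 and -1 when 2 is invertible in F, so that there are at
    most 2^m of them ([finitely_many_commuting_involutions]). *)

(** * Multiplicative maps between groups *)

Section MultiplicativeMaps.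
Local Open Scope group_scope.
Context {G K : groupType} (f : {multiplicative G -> K}).

Lemma multf1 : f 1 = 1.
Proof. by apply: (mulgI (f 1)); rewrite -gmulfM !mulg1. Qed.

Lemma multfV x : f x^-1 = (f x)^-1.
Proof. by apply: (mulgI (f x)); rewrite -gmulfM !mulgV multf1. Qed.

Lemma multfX x k : f (x ^+ k) = f x ^+ k.
Proof. by elim: k => [|k IH]; rewrite ?multf1 // !expgS gmulfM IH. Qed.

Lemma multf_expz x (n : int) : f (gexpz x n) = gexpz (f x) n.
Proof. by case: n => k; rewrite /= ?multfV multfX. Qed.
End MultiplicativeMaps.

Lemma gexpz_sqr (gT : groupType) (x : gT) (n : int) :
  gexpz (gexpz x n) n = (x ^+ (`|n| * `|n|))%g.
Proof.
case: n => k /=; first by rewrite expgnA.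
by rewrite expVgn invgK expgnA.
Qed.

(** * The base group embeds in an ascending HNN extension *)

Section HnnBase.
Local Open Scope group_scope.
Context {G : groupType} (phi : {multiplicative G -> G}).

Definition letter_height (l : G + bool) : int :=
  match l with inl _ => 0%R | inr b => if b then 1%R else (-1)%R end.

Definition word_height (u : hnn_word G) : int :=
  foldr (fun l h => (letter_height l + h)%R) 0%R u.

(** Moving all the stable letters of tau^h u to the right end turns each base
    letter g into phi^j(g), where j is the exponent sum of the stable letters
    before it. Only j >= 0 is meaningful; the absolute value makes the function
    total. *)
Fixpoint pushed (h : int) (u : hnn_word G) : G :=
  if u is l :: v then
    (if l is inl g then iter `|h|%N phi g else 1)
      * pushed (h + letter_height l)%R v
  else 1.

Lemma word_height_cat u v :
  word_height (u ++ v) = (word_height u + word_height v)%R.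
Proof. by elim: u => [|l u IH] /=; rewrite ?add0r // IH addrA. Qed.

Lemma pushed_cat h u v :
  pushed h (u ++ v) = pushed h u * pushed (h + word_height u)%R v.
Proof.
elim: u h => [|l u IH] h /=; first by rewrite mul1g addr0.
by rewrite IH mulgA addrA.
Qed.

(** Once the starting height is so large that no negative height occurs, pushing
    respects every defining relation; the bound depends on the derivation of the
    congruence, which is why it is existential. *)
Lemma pushed_rel u v : hnn_rel phi u v ->
  word_height u = word_height v /\
  exists k : int, forall h, (k <= h)%R -> pushed h u = pushed h v.
Proof.
have phi1 m : iter m phi 1 = 1 by elim: m => //= m ->; rewrite multf1.
have phiM m g h : iter m phi (g * h) = iter m phi g * iter m phi h.
  by elim: m => //= m ->; rewrite gmulfM.
elim=> {u v} /=.
- by move=> u; split=> //; exists 0%R.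
- by move=> u v _ [-> [k Hk]]; split=> //; exists k => h /Hk.
- move=> u v w _ [-> [k Hk]] _ [-> [l Hl]]; split=> //.
  by exists (Num.max k l) => h; rewrite ge_max => /andP[/Hk-> /Hl].
- move=> u u' v v' _ [eu [k Hk]] _ [ev [l Hl]].
  rewrite !word_height_cat eu ev; split=> //.
  exists (Num.max k (l - word_height u')) => h.
  rewrite ge_max lerBlDr => /andP[/Hk Hu /Hl Hv].
  by rewrite !pushed_cat Hu eu Hv.
- by split=> //; exists 0%R => h _; rewrite phi1 mulg1.
- by move=> g h; split=> //; exists 0%R => k _; rewrite addr0 !mulg1 phiM.
- by case; split=> //; exists 0%R => h _; rewrite !mulg1.
- move=> g; split=> //; exists 0%R => h h0.
  rewrite !mul1g !mulg1 -iterSr; congr (iter _ phi g).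
  by lia.
Qed.

(** Pushing the one-letter word g gives phi^k(g), so equality in the extension
    of two base elements means that some iterate of phi identifies them. *)
Lemma hnn_base_inj : injective phi -> injective (hnn_base phi).
Proof.
move=> phi_inj g h /hnn_classP/pushed_rel[_ [k Hk]].
have := Hk _ (ler_norm k); rewrite /= !mulg1.
by elim: `|_|%N => //= m IH /phi_inj.
Qed.
End HnnBase.

(** * Commuting involutions away from characteristic 2 *)

Lemma involution_diagonalizable {F : fieldType} {m} (A : 'M[F]_m) :
  2%:R != 0 :> F -> A *m A = 1%:M -> diagonalizable A.
Proof.
case: m A => [|m] A two_neq0 AA1.
  by exists 1%:M; rewrite ?unitmx1 //; apply/is_diag_mxP => -[].
apply/diagonalizableP; exists [:: 1; -1].
  rewrite /= inE andbT; apply: contraNneq two_neq0 => e.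
  by rewrite -[2%:R]/(1 + 1) {1}e addNr.
apply: mxminpoly_min; rewrite !big_cons big_nil mulr1 rmorphM /=.
rewrite !rmorphB /= !horner_mx_C horner_mx_X rmorphN rmorph1 opprK.
by rewrite mulrDr mulr1 mulrBl mul1r [A * A]AA1 addrA subrK subrr.
Qed.

(** In a common eigenbasis each s i is determined by the signs of its m
    eigenvalues, so among 2^m + 1 of them two agree. *)
Lemma finitely_many_commuting_involutions {F : fieldType} {m}
    (s : nat -> 'M[F]_m) :
  2%:R != 0 :> F -> (forall i, s i *m s i = 1%:M) ->
  (forall i j, comm_mx (s i) (s j)) -> ~ injective s.
Proof.
move=> two_neq0 ss1 s_comm s_inj.
pose N := #|{ffun 'I_m -> bool}|.
have [] := proj1 (codiagonalizableP [seq s i | i <- iota 0 N.+1]).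
  split=> [_ _ /mapP[i _ ->] /mapP[j _ ->]|_ /mapP[i _ ->]].
    exact: s_comm.
  exact: involution_diagonalizable.
move=> P Pu /allP PsD.
have /choice[D sD] (i : 'I_N.+1) :
    exists D, s i = invmx P *m diag_mx D *m P.
  have : s i \in [seq s i | i <- iota 0 N.+1] by rewrite map_f // mem_iota /=.
  move=> /PsD/(similar_diagLR Pu)[D ->]; exists D.
  by rewrite conjVmx.
have D_sqr i j : (D i 0 j == 1) || (D i 0 j == -1).
  have := congr1 (fun A => (P *m A *m invmx P) j j) (ss1 i).
  rewrite sD mulmx1 !mulmxA !(mulmxK Pu) mulmxV // mul1mx.
  rewrite mulmx_diag !mxE eqxx mulr1n.
  by move=> /eqP; rewrite -expr2 sqrf_eq1.
pose sgn (i : 'I_N.+1) := [ffun j => D i 0 j == 1].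
have sgn_inj : injective sgn.
  move=> i j /ffunP eij; apply/ord_inj/s_inj; rewrite !sD.
  congr (_ *m diag_mx _ *m _); apply/rowP => l; have := eij l; rewrite !ffunE.
  have := D_sqr i l; have := D_sqr j l.
  case: (D i 0 l =P 1) => [->|_]; case: (D j 0 l =P 1) => [->|_] //=.
  by move=> /eqP-> /eqP->.
by have := leq_card sgn sgn_inj; rewrite card_ord ltnn.
Qed.

(** * Divisibility read off the roots in finite extensions *)

Lemma irreducible_factor {F : fieldType} (p : {poly F}) :
  (1 < size p)%N -> exists2 r, irreducible_poly r & r %| p.
Proof.
have [k] := ubnP (size p); elim: k p => // k IH p /ltnSE le_pk p_gt1.
have [p_irr|] := pselect (irreducible_poly p); first by exists p.
move/not_andP => -[//|] /existsNP[q] /not_implyP[q_neq1].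
move=> /not_implyP[q_dvd] /negP q_neqp.
have p_neq0 : p != 0 by rewrite -size_poly_gt0 ltnW.
have q_neq0 : q != 0 by apply: contraNneq p_neq0 => q0; rewrite -dvd0p -q0.
have lt_qp : (size q < size p)%N.
  by rewrite ltn_neqAle dvdp_leq // andbT -dvdp_size_eqp // in q_neqp *.
have [||r r_irr r_q] := IH q.
- exact: leq_trans lt_qp le_pk.
- by rewrite ltn_neqAle eq_sym q_neq1 size_poly_gt0.
- by exists r => //; apply: dvdp_trans q_dvd.
Qed.

(** Each irreducible factor r of p has a root in F[X]/(r), which is then a root
    of q, so r divides q. Quantifying over finite extensions replaces an
    algebraic closure of F. *)
Lemma dvdp_exp_of_roots {F : fieldType} (p q : {poly F}) : p != 0 ->
  (forall (L : fieldExtType F) (z : L),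
     root (map_poly (in_alg L) p) z -> root (map_poly (in_alg L) q) z) ->
  exists k, p %| q ^+ k.
Proof.
have [k] := ubnP (size p); elim: k p => // k IH p /ltnSE le_pk p_neq0 pq.
have [p_le1|p_gt1] := leqP (size p) 1.
  by exists 0%N; rewrite expr0 dvdp1 eqn_leq p_le1 size_poly_gt0.
have [r r_irr /dvdpP[p' pE]] := irreducible_factor p p_gt1.
have r_q : r %| q.
  have [L _ [z rz _]] := irredp_FAdjoin r_irr.
  have qz : root (map_poly (in_alg L) q) z.
    by apply: pq; rewrite pE rmorphM rootM rz orbT.
  have r_ncop : ~~ coprimep r q.
    rewrite -(coprimep_map (in_alg L)); apply/negP => /coprimep_root/(_ rz).
    by rewrite (rootP qz) eqxx.
  have [_ r_min] := r_irr; apply: dvdp_trans (dvdp_gcdr r q).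
  have /r_min/(_ (dvdp_gcdl r q)) : size (gcdp r q) != 1 by [].
  by rewrite eqp_sym => /andP[].
have [p'_neq0 r_neq0] : p' != 0 /\ r != 0.
  by apply/andP; rewrite -negb_or -mulf_eq0 -pE.
have [|||l p'_q] := IH p' => //.
- apply: leq_trans le_pk; rewrite pE size_mul //.
  case: r_irr => r_gt1 _; rewrite -(subnKC r_gt1) addnC !addSn /=.
  by rewrite ltnS leq_addl.
- by move=> L z p'z; apply: pq; rewrite pE rmorphM rootM p'z.
- by exists l.+1; rewrite pE exprSr dvdp_mul.
Qed.

(** * Matrices conjugate to a proper power of themselves *)

(** A left eigenvector v of A for a is one of A^q for a^q, and T carries it to
    an eigenvector of A = T^-1 A^q T. *)
Lemma root_char_poly_conj_exp {F : fieldType} {m} (A T : 'M[F]_m.+1) q a :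
  T \is a GRing.unit -> T * A = A ^+ q * T ->
  root (char_poly A) a -> root (char_poly A) (a ^+ q).
Proof.
move=> Tu TA; rewrite -!eigenvalue_root_char => /eigenvalueP[v vA v_neq0].
have vAX k : v *m A ^+ k = a ^+ k *: v.
  elim: k => [|k IH]; first by rewrite expr0 mulmx1 scale1r.
  by rewrite exprS -[A * _]/(A *m _) mulmxA vA -scalemxAl IH scalerA -exprS.
apply/eigenvalueP; exists (v *m T).
  rewrite -mulmxA -[T *m A]/(T * A) TA -[_ * T]/(_ *m T).
  by rewrite mulmxA vAX scalemxAl.
by apply: contraNneq v_neq0 => vT0; rewrite -(mulmxK Tu v) vT0 mul0mx.
Qed.

(** A common multiple of all the differences q^j - q^i with i < j < s: one
    exponent that works for all roots, in all extensions, at once. *)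
Definition power_gaps (q s : nat) : nat :=
  (\prod_(j < s) \prod_(i < j) (q ^ j - q ^ i))%N.

Lemma power_gaps_gt0 q s : (1 < q)%N -> (0 < power_gaps q s)%N.
Proof.
move=> q_gt1; apply: prodn_gt0 => j; apply: prodn_gt0 => i.
by rewrite subn_gt0 ltn_exp2l.
Qed.

(** The powers a^(q^i) with i < size p are too many roots of p to be distinct,
    and a^(q^i) = a^(q^j) makes a a root of unity. *)
Lemma root_of_unity_of_stable_roots {L : fieldType} (p : {poly L}) q a :
  (1 < q)%N -> p != 0 -> ~~ root p 0 ->
  (forall z, root p z -> root p (z ^+ q)) ->
  root p a -> a ^+ power_gaps q (size p) = 1.
Proof.
move=> q_gt1 p_neq0 p0 p_stable pa.
have a_neq0 : a != 0 by apply: contraNneq p0 => <-.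
have pX i : root p (a ^+ (q ^ i)).
  by elim: i => [|i IH]; rewrite ?expr1 // expnSr exprM; apply: p_stable.
pose rs := [seq a ^+ (q ^ i)%N | i <- iota 0 (size p)].
have : ~~ uniq rs.
  apply/negP => rs_uniq.
  have rs_roots : all (root p) rs by apply/allP => _ /mapP[i _ ->].
  have := max_poly_roots p_neq0 rs_roots rs_uniq.
  by rewrite size_map size_iota ltnn.
case/(uniqPn 0) => i [j [lt_ij]]; rewrite size_map size_iota => lt_jp.
have lt_ip := ltn_trans lt_ij lt_jp.
rewrite !(nth_map 0%N) ?size_iota // !nth_iota // !add0n => aij.
have a_gap : a ^+ (q ^ j - q ^ i)%N = 1.
  apply: (mulIf (expf_neq0 (q ^ i) a_neq0)).
  by rewrite -exprD subnK ?mul1r // leq_exp2l // ltnW.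
have /dvdnP[k ->] : (q ^ j - q ^ i %| power_gaps q (size p))%N.
  rewrite /power_gaps (bigD1 (Ordinal lt_jp)) //= dvdn_mulr //.
  by rewrite (bigD1 (Ordinal lt_ij)) //= dvdn_mulr.
by rewrite mulnC exprM a_gap expr1n.
Qed.

(** All eigenvalues of A in extensions of F are N-th roots of unity, so its
    characteristic polynomial divides a power of X^N - 1, and Cayley-Hamilton
    applies. *)
Lemma unipotent_power {F : fieldType} {m} (A T : 'M[F]_m.+1) q :
  (1 < q)%N -> A \is a GRing.unit -> T \is a GRing.unit ->
  T * A = A ^+ q * T ->
  exists N k, (0 < N)%N /\ (A ^+ N - 1) ^+ k = 0.
Proof.
move=> q_gt1 Au Tu TA.
set chi := char_poly A; set N := power_gaps q (size chi).
have chi_neq0 : chi != 0 by rewrite -size_poly_gt0 size_char_poly.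
have [|k /dvdpP[h chi_dvd]] := dvdp_exp_of_roots chi ('X^N - 1) chi_neq0.
  move=> L z; rewrite rmorphB rmorph1 /= map_polyXn => chi_z.
  rewrite /root !hornerE subr_eq0; apply/eqP.
  have mapA (B : 'M[F]_m.+1) :
      B \is a GRing.unit -> map_mx (in_alg L) B \is a GRing.unit.
    by move=> Bu; rewrite [_ \is a _]map_unitmx.
  rewrite /N -(size_map_poly (in_alg L)).
  apply: root_of_unity_of_stable_roots => //.
  - by rewrite map_poly_eq0.
  - rewrite /chi map_char_poly -eigenvalue_root_char; apply/eigenvalueP => -[v].
    rewrite scale0r => vA; case/eqP.
    by rewrite -(mulmxK (mapA _ Au) v) vA mul0mx.
  - rewrite /chi map_char_poly => y.
    apply: root_char_poly_conj_exp (mapA _ Tu) _.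
    rewrite -[_ * _]/(_ *m _) -map_mxM -[_ *m _]/(_ * _) TA.
    by rewrite -rmorphXn -[RHS]/(_ *m _) -map_mxM.
exists N, k; split; first exact: power_gaps_gt0.
have := congr1 (horner_mx A) chi_dvd; rewrite rmorphM /= Cayley_Hamilton mulr0.
by rewrite rmorphXn rmorphB rmorphXn rmorph1 /= horner_mx_X.
Qed.

(** In characteristic p a unipotent matrix B satisfies
    B^(p^k) - 1 = (B - 1)^(p^k) = 0 for large k. *)
Lemma torsion_of_conj_exp {F : fieldType} {m} (p q : nat) (x T : GL m F) :
  p \in [pchar F] -> (1 < q)%N -> (T * x = x ^+ q * T)%g ->
  exists2 N, (0 < N)%N & (x ^+ N = 1)%g.
Proof.
case: m x T => [|m] x T p_char q_gt1 Tx.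
  (* GL(0, F) is trivial; square matrices form a nonzero ring from size 1 on. *)
  by exists 1%N => //; apply: val_inj; apply/matrixP => -[].
have mxX k : gl_mx (x ^+ k)%g = (x : 'M_m.+1) ^+ k.
  by elim: k => [|k IH]; rewrite ?expr0 // expgS exprS -IH.
have TxM : (T : 'M_m.+1) * x = (x : 'M_m.+1) ^+ q * T.
  by rewrite -mxX; exact: (congr1 (@gl_mx _ _) Tx).
have [N [k [N_gt0 Nk]]] :=
  unipotent_power _ _ _ q_gt1 (gl_unit x) (gl_unit T) TxM.
have p_charM : p \in [pchar 'M[F]_m.+1] by rewrite pchar_lalg.
have p_gt1 : (1 < p)%N := prime_gt1 (pcharf_prime p_char).
exists (N * p ^ k)%N; first by rewrite muln_gt0 N_gt0 expn_gt0 ltnW.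
apply: val_inj; rewrite [LHS]mxX exprM; apply/eqP; rewrite -subr_eq0; apply/eqP.
have frob (B : 'M[F]_m.+1) i : B ^+ (p ^ i) - 1 = (B - 1) ^+ (p ^ i).
  elim: i => [|i IH]; first by rewrite !expr1.
  rewrite expnSr !exprM -IH -!(pFrobenius_autE p_charM).
  rewrite pFrobenius_autB_comm ?pFrobenius_aut1 //.
  exact: commr1.
by rewrite [LHS]frob -(subnK (ltnW (ltn_expl k p_gt1))) exprD Nk mulr0.
Qed.

(** * Injectivity of the substitution t |-> t^n *)

Lemma laurent_poly_inj (K : fieldType) : injective (@laurent_poly K).
Proof. by move=> p q /(congr1 val)/eqP; rewrite tofrac_eq => /eqP. Qed.

Lemma laurent_substC {K : fieldType} n (a : K) :
  laurent_subst n (laurentC a) = laurentC a.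
Proof. by rewrite laurent_subst_poly map_polyC hornerC. Qed.

Lemma laurent_subst_horner {K : fieldType} n (p : {poly K}) x :
  laurent_subst n (map_poly (@laurentC K) p).[x]
  = (map_poly (@laurentC K) p).[laurent_subst n x].
Proof.
rewrite -horner_map -map_poly_comp; congr (_.[_]).
by apply: eq_map_poly => a; apply: laurent_substC.
Qed.

(** Substituting twice replaces t by t^(n^2), whose exponent is positive
    whatever the sign of n; on polynomials this is composition with X^(n^2). *)
Lemma laurent_subst_inj {K : fieldType} {n : int} :
  n != 0 -> injective (@laurent_subst K n).
Proof.
move=> n_neq0.
suff subst_eq0 (f : laurent K) : laurent_subst n f = 0 -> f = 0.
  exact: raddf_inj subst_eq0.
move=> fn0.
have X_neq0 : laurentX K != 0.
  rewrite -(rmorph0 (@laurent_poly K)) (inj_eq (laurent_poly_inj K)).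
  by rewrite polyX_eq0.
case: (laurent_frac f) (laurent_fracM f) => p k /= fp.
suff p0 : p = 0.
  apply: (mulIf (expf_neq0 k X_neq0)).
  by rewrite fp p0 mul0r (rmorph0 (@laurent_poly K)).
have := congr1 (laurent_subst n) fp.
rewrite rmorphM /= fn0 mul0r laurent_subst_poly.
move=> /(congr1 (laurent_subst n)); rewrite rmorph0 laurent_subst_horner.
rewrite rmorphXz ?laurentX_unit //= laurent_substX exprz_exp.
have -> : n * n = (`|n| * `|n|)%N :> int by lia.
set m := (`|n| * `|n|)%N.
have -> : (map_poly (@laurentC K) p).[laurentX K ^ m]
    = laurent_poly (p \Po 'X^m).
  by rewrite map_poly_comp -[_ ^ m](rmorphXn (@laurent_poly K)) horner_map.
rewrite -(rmorph0 (@laurent_poly K)) => /laurent_poly_inj/esym/eqP.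
by rewrite comp_poly_eq0 ?size_polyXn => [/eqP|] //; rewrite /m; lia.
Qed.

Lemma map_GL_inj {n} {R S : comUnitRingType} (f : {rmorphism R -> S}) :
  injective f -> injective (@map_GL n R S f).
Proof.
move=> f_inj A B /(congr1 val)/matrixP AB; apply/val_inj/matrixP => i j.
by apply: f_inj; have := AB i j; rewrite !mxE.
Qed.

Lemma rhoG_inj {n : int} : n != 0 -> injective (rhoG n).
Proof.
move=> n_neq0 x y /(congr1 val) xy; apply: val_inj.
exact: map_GL_inj (laurent_subst_inj n_neq0) _ _ xy.
Qed.

(** * Infinitely many commuting involutions in G *)

Local Notation L := (laurent 'F_2).

Lemma t_exp_inj : injective (fun k : nat => t ^+ k).
Proof.
move=> i j; rewrite /= /t /laurentX -!rmorphXn => /laurent_poly_inj.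
by move=> /(congr1 (fun p : {poly _} => size p)); rewrite !size_polyXn => -[].
Qed.

(** In characteristic 2,
    (t^i + t^-i + t^j + t^-j) t^(i+j) = (t^i + t^j) (1 + t^(i+j)). *)
Lemma t_exp_addV_inj (i j : nat) : (0 < i)%N ->
  t ^ i + t ^ (- i%:Z) = t ^ j + t ^ (- j%:Z) -> i = j.
Proof.
move=> i_gt0 eij.
have tu := t_unit.
have tV (k : nat) : t ^ (- k%:Z) * t ^+ k = 1.
  by rewrite -exprnN mulVr // unitrX.
have : (t ^+ i + t ^+ j) * (1 + t ^+ (i + j)) = 0.
  have -> : (t ^+ i + t ^+ j) * (1 + t ^+ (i + j))
    = (t ^ i + t ^ (- i%:Z) + (t ^ j + t ^ (- j%:Z))) * t ^+ (i + j).
    rewrite exprD -[t ^ i]/(t ^+ i) -[t ^ j]/(t ^+ j).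
    transitivity ((t ^+ i + t ^+ j) * (t ^+ i * t ^+ j)
      + (t ^ (- i%:Z) * t ^+ i) * t ^+ j + (t ^ (- j%:Z) * t ^+ j) * t ^+ i).
      by rewrite !tV; ring.
    by ring.
  by rewrite eij addLL mul0r.
have eq_of_add0 (x y : L) : x + y = 0 -> x = y.
  by move=> xy; rewrite -[x]addr0 -(addLL y) addrA xy add0r.
move=> /eqP; rewrite mulf_eq0 => /orP[] /eqP/eq_of_add0.
  exact: t_exp_inj.
by rewrite -(expr0 t) => /t_exp_inj ij; move: i_gt0; rewrite -(leq_add2r j) -ij.
Qed.

(** The matrix w w^T for w = (0,1,1), the vector fixed by c and d. *)
Definition twist : 'M[L]_3 := \matrix_(i, j) ((i != 0) && (j != 0))%:R.

Lemma twist_sqr : twist *m twist = 0.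
Proof.
apply/matrixP => i j; rewrite !mxE !big_ord_recl big_ord0 !mxE /=.
case: (i != 0); case: (j != 0);
  by rewrite /= ?mulr0 ?mul0r ?mulr1 ?add0r ?addr0 ?addLL.
Qed.

Lemma mul_twist (a b : L) :
  (1%:M + a *: twist) *m (1%:M + b *: twist) = 1%:M + (a + b) *: twist.
Proof.
rewrite mulmxDl mul1mx mulmxDr mulmx1 -scalemxAl -scalemxAr twist_sqr.
by rewrite !scaler0 addr0 scalerDl -addrA [b *: _ + _]addrC.
Qed.

(** With v = u^-1 the product of the two matrices is unitriangular for the flag
    <w> < <w, e> < L^3, where e = (1,0,0); its superdiagonal entries in this
    basis are 1 + v and 1 + u, whose product u + v is the coefficient of the
    square. *)
Lemma cmx_dmx_sqr (u v : L) : u * v = 1 ->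
  (cmx u *m dmx v) *m (cmx u *m dmx v) = 1%:M + (u + v) *: twist.
Proof.
move=> uv1.
pose M : 'M[L]_3 := \matrix_(i, j)
  (if j == 0 then if i == 0 then 1 else 1 + v else if i == j then u else 1 + u).
have -> : cmx u *m dmx v = M.
  apply/matrixP => i j; rewrite !mxE !big_ord_recl big_ord0 !mxE.
  by case: i => -[|[|[|//]]] ?; case: j => -[|[|[|//]]] ?; rewrite /=; ring: uv1.
(* Characteristic 2 enters by exhibiting z such that the two sides of an entry
   differ by 2z as integer polynomials modulo uv = 1. *)
have cancel (x y z : L) : x = y + (z + z) -> x = y by rewrite addLL addr0.
apply/matrixP => i j; rewrite !mxE !big_ord_recl big_ord0 !mxE.
case: i => -[|[|[|//]]] ?; case: j => -[|[|[|//]]] ?; rewrite /=;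
  first [ by apply: (@cancel _ _ ((1 + u) * (1 + v))); ring: uv1
        | by apply: (@cancel _ _ ((1 + u) ^+ 2)); ring: uv1
        | by apply: (@cancel _ _ (1 + u + u ^+ 2)); ring: uv1 ].
Qed.

Definition cG : G := Sub c (mem_gen (mem_head c [:: d])).
Definition dG : G := Sub d (mem_gen (mem_last c [:: d])).

Lemma val_gexpz (x : G) (n : int) : val (gexpz x n) = gexpz (val x) n.
Proof. exact: (multf_expz val). Qed.

Lemma gl_mx_gexpz_c (n : int) : gexpz c n = cmx (t ^ n) :> 'M[L]_3.
Proof. exact/esym/(rho_pow n cmxM cmx1). Qed.

Lemma gl_mx_gexpz_d (n : int) : gexpz d n = dmx (t ^ n) :> 'M[L]_3.
Proof. exact/esym/(rho_pow n dmxM dmx1). Qed.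

(** The exponent i + 1 avoids the trivial element obtained from exponent 0. *)
Definition involution (i : nat) : G :=
  ((gexpz cG i.+1 * gexpz dG (- i.+1%:Z)) ^+ 2)%g.

Lemma involutionE i : val (involution i)
  = 1%:M + (t ^ i.+1 + t ^ (- i.+1%:Z)) *: twist :> 'M[L]_3.
Proof.
rewrite /involution expg2 -cmx_dmx_sqr.
  by rewrite -gl_mx_gexpz_c -gl_mx_gexpz_d -!(val_gexpz cG) -!(val_gexpz dG).
by rewrite -exprzDr ?t_unit // subrr.
Qed.

Lemma involution_inj : injective involution.
Proof.
move=> i j /(congr1 (fun x : G => gl_mx (val x))); rewrite !involutionE.
move/addrI/matrixP/(_ ord_max ord_max); rewrite !mxE !mulr1.
by move/t_exp_addV_inj => /(_ isT) [].
Qed.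

Lemma involution_mulE i j : val (involution i * involution j)%g
  = 1%:M + (t ^ i.+1 + t ^ (- i.+1%:Z) + (t ^ j.+1 + t ^ (- j.+1%:Z)))
    *: twist :> 'M[L]_3.
Proof. by rewrite -mul_twist -!involutionE. Qed.

Lemma involution_comm i j :
  (involution i * involution j = involution j * involution i)%g.
Proof.
do 2!apply: val_inj; rewrite [LHS]involution_mulE [RHS]involution_mulE.
by rewrite [X in X *: _]addrC.
Qed.

Lemma involution_sqr i : (involution i * involution i = 1)%g.
Proof.
by do 2!apply: val_inj; rewrite [LHS]involution_mulE addLL scale0r addr0.
Qed.

(** * Non-linearity *)

Lemma cG_infinite_order k : (cG ^+ k = 1)%g -> k = 0%N.
Proof.
move=> /(congr1 (fun x : G => gl_mx (val x))).
rewrite -[(cG ^+ k)%g]/(gexpz cG k) val_gexpz gl_mx_gexpz_c.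
move=> /matrixP/(_ 0 ord_max); rewrite !mxE /= => /(congr1 (+%R 1)).
by rewrite addrA addLL add0r addr0 -[t ^ k]/(t ^+ k) -(expr0 t) => /t_exp_inj.
Qed.

Lemma rhoG_c n : rhoG n cG = gexpz cG n.
Proof. by apply: val_inj; rewrite val_gexpz /= rho_c. Qed.

Lemma rhoG_rhoG_c n : rhoG n (rhoG n cG) = (cG ^+ (`|n| * `|n|))%g.
Proof.
rewrite rhoG_c -gexpz_sqr -[in RHS]rhoG_c.
exact: (multf_expz (rhoG n)).
Qed.

Theorem theorem1p3 (n : int) (hn : 1 < `|n|) : ~ linear_group (H n).
Proof.
case=> F [m [f f_inj]].
have n_neq0 : n != 0 by lia.
pose e : {multiplicative G -> GL m F} := f \o hnn_base (rhoG n).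
have e_inj : injective e.
  exact: inj_comp f_inj (hnn_base_inj _ (rhoG_inj n_neq0)).
have [two0|two_neq0] := eqVneq (2%:R : F) 0.
  pose T := f (hnn_stable (rhoG n)).
  have Te g : (T * e g = e (rhoG n g) * T)%g.
    rewrite [e g]/= [e (rhoG n g)]/= -hnn_stableJ !gmulfM (multfV f).
    by rewrite mulgVK.
  (* Conjugating by the square of T makes the exponent n^2 positive. *)
  have [|||N N_gt0] := torsion_of_conj_exp 2 (`|n| * `|n|) (e cG) (T * T)%g.
  - by rewrite inE /= two0 eqxx.
  - by lia.
  - by rewrite -mulgA Te mulgA Te rhoG_rhoG_c -mulgA (multfX e).
  rewrite -(multfX e) -(multf1 e) => /e_inj/cG_infinite_order N0.
  by rewrite N0 in N_gt0.
apply: (finitely_many_commuting_involutions (fun i => e (involution i))).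
- by [].
- by move=> i; rewrite -gl_mxM -gmulfM involution_sqr multf1.
- by move=> i j; rewrite /comm_mx -!gl_mxM -!gmulfM involution_comm.
- by move=> i j /= eij; apply/involution_inj/e_inj/val_inj.
Qed.
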